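(* Let $(R,\mathfrak m)$ be a commutative Noetherian local ring satisfying $\mathfrak m^4=0$ and $\mathfrak m^3\neq 0$. Let $M$ and $N$ be finitely generated $R$-modules, each with an eventually linear minimal free resolution over $R$, and suppose that $\operatorname{Ext}_R^i(M,R)=0=\operatorname{Ext}_R^i(N,R)$ for all $i\gg 0$. If the Betti sequences of $M$ and $N$ have exponential growth of bases $a$ and $b$, respectively, then $a=b$.
   Context: Write $k=R/\mathfrak m$. The Betti numbers of a finitely generated $R$-module $M$ are $b_n(M)=\dim_k\operatorname{Tor}_n^R(M,k)$, and its Betti sequence is $\{b_i(M)\}_{i\ge 0}$. Eventually linear: Let $\mathbf F=(F_i,\partial_i)$ be the minimal free resolution of $M$. The associated graded complex is $\operatorname{gr}_{\mathfrak m}(\mathbf F)=\bigoplus_{j\in\mathbb Z}\operatorname{gr}_{\mathfrak m}(\mathbf F)^j$, where $\operatorname{gr}_{\mathfrak m}(\mathbf F)^j$ is the complex whose $i$-th term is $\mathfrak m^{j-i}F_i/\mathfrak m^{j-i+1}F_i$ and whose differentials $\mathfrak m^{j-i}F_i/\mathfrak m^{j-i+1}F_i\to \mathfrak m^{j-i+1}F_{i-1}/\mathfrak m^{j-i+2}F_{i-1}$ are induced by $\partial_i$ (convention: $\mathfrak m^n=R$ for $n\le 0$). The linearity defect of $M$ is $\operatorname{ld}_R(M)=\inf\{n\in\mathbb N\mid \operatorname H_i(\operatorname{gr}_{\mathfrak m}(\mathbf F))=0\text{ for all } i\ge n\}$. The resolution $\mathbf F$ is eventually linear if $\operatorname{ld}_R(M)$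 is finite and positive. Exponential growth of base $a$ (where $1<a\in\mathbb R$) of a Betti sequence $\{b_i(M)\}$: there exist a real $\beta>0$ and a sequence of real numbers $\{\rho_i\}$ with $\rho_i/a^i\to 0$ such that $\beta a^i-\rho_i\le b_i(M)\le\beta a^i+\rho_i$ for all $i\gg 0$. *)

(* Defs.v *)
From HB Require Import structures.
From mathcomp Require Import all_boot all_order all_algebra.
From mathcomp Require Import generic_quotient ring_quotient.
From mathcomp Require Import boolp classical_sets filter reals.
From mathcomp Require Import topology normedtype sequences.

Set Implicit Arguments.
Unset Strict Implicit.
Unset Printing Implicit Defensive.

Import Order.TTheory GRing.Theory Num.Theory.
Import numFieldNormedType.Exports.

Local Open Scope classical_set_scope.
Local Open Scope ring_scope.

Section Modules.
Variable R : comNzRingType.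

Definition submodule (V : lmodType R) (S : set V) : Prop :=
  [/\ S 0, forall x y, S x -> S y -> S (x + y)
    & forall (r : R) x, S x -> S (r *: x)].

(* The finite sums of products r *: x with r in I and x in S: the submodule IS
   when I is an ideal, and the span of S when I = R. *)
Definition smul (V : lmodType R) (I : set R) (S : set V) : set V :=
  [set v | exists s : seq (R * V),
     (forall p, p \in s -> I p.1 /\ S p.2) /\ v = \sum_(p <- s) p.1 *: p.2].

Definition fg_submodule (V : lmodType R) (S : set V) : Prop :=
  exists s : seq V, S = smul [set: R] [set` s].

Definition finitely_generated (V : lmodType R) : Prop :=
  fg_submodule [set: V].

Definition ideal (I : set R) : Prop := submodule (I : set R^o).

Definition noetherian : Prop :=
  forall I : set R, ideal I -> fg_submodule (I : set R^o).

Definition maximal_ideal (m : set R) : Prop :=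
  [/\ ideal m, m <> setT
    & forall I : set R, ideal I -> m `<=` I -> I = m \/ I = setT].

Record local_ring (m : set R) : Prop := LocalRing {
  local_maximal : maximal_ideal m;
  local_unique : forall n : set R, maximal_ideal n -> n = m }.

Fixpoint ideal_exp (I : set R) (n : nat) : set R :=
  if n is n'.+1 then smul I (ideal_exp I n' : set R^o) else setT.

(* I^p = R for p <= 0. *)
Definition ideal_expz (I : set R) (p : int) : set R :=
  if p is Posz n then ideal_exp I n else setT.

End Modules.

Notation "I *s S" := (smul I S) (at level 40).

Section ResidueField.
Variables (R : comNzRingType) (m : set R).

Definition residue_ideal (hm : maximal_ideal m) : {pred R} :=
  fun x => x \in m.

Variable hm : maximal_ideal m.

Fact residue_ideal_closed : idealr_closed (residue_ideal hm).
Proof.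
have [[m0 mD mM] mT _] := hm; split.
- exact/mem_set.
- apply/negP => /set_mem m1; apply: mT; apply/seteqP; split=> // x _.
  by have := mM x _ m1; rewrite /GRing.scale /= mulr1.
- move=> a x y /set_mem mx /set_mem my; apply/mem_set/mD => //.
  exact: (mM a).
Qed.

HB.instance Definition _ :=
  isIdealr.Build R (residue_ideal hm) residue_ideal_closed.

Definition residue_field : Type := {ideal_quot (residue_ideal hm)}.

HB.instance Definition _ :=
  NzRingQuotient.on residue_field.
HB.instance Definition _ := GRing.ComNzRing.on residue_field.

Definition residue : R -> residue_field := (\pi_residue_field)%qT.

Fact residue_is_zmod_morphism : zmod_morphism residue.
Proof. exact: pi_is_zmod_morphism. Qed.
Fact residue_is_monoid_morphism : monoid_morphism residue.
Proof. exact: pi_is_monoid_morphism. Qed.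
HB.instance Definition _ :=
  GRing.isZmodMorphism.Build R residue_field residue residue_is_zmod_morphism.
HB.instance Definition _ :=
  GRing.isMonoidMorphism.Build R residue_field residue
    residue_is_monoid_morphism.

Lemma residue_eq0 x : (residue x == 0) = (x \in m).
Proof.
by rewrite -(rmorph0 residue) /residue -Quotient.idealrBE subr0.
Qed.

Fact residue_inv_ex (x : residue_field) :
  exists y : residue_field, (x != 0 -> y * x = 1) /\ (x = 0 -> y = 0).
Proof.
have [->|x0] := eqVneq x 0; first by exists 0.
elim/quotW: x x0 => r; rewrite -/(residue r) => r0.
have [[m0 mD mM] mT mmax] := hm.
pose I := [set z : R | exists u a, m u /\ z = u + a * r].
have Iid : ideal I.
  split.
  - by exists 0, 0; rewrite mul0r addr0.
  - move=> _ _ [u [a [mu ->]]] [v [b [mv ->]]].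
    by exists (u + v), (a + b); split; [exact: mD|rewrite mulrDl addrACA].
  - move=> c _ [u [a [mu ->]]]; exists (c * u), (c * a); split.
      exact: (mM c).
    by rewrite -mulrA -mulrDr.
have mI : m `<=` I by move=> u mu; exists u, 0; rewrite mul0r addr0.
have [Im|IT] := mmax _ Iid mI.
  have : m r by rewrite -Im; exists 0, 1; rewrite mul1r add0r.
  by move=> /mem_set; rewrite -residue_eq0 (negbTE r0).
have [u [a [mu au]]] : I 1 by rewrite IT.
exists (residue a); split=> [_|r0']; last by rewrite r0' eqxx in r0.
have u0 : residue u = 0 by apply/eqP; rewrite residue_eq0 mem_set.
by rewrite -[LHS]add0r -u0 -rmorphM -rmorphD -au rmorph1.
Qed.

Definition residue_inv (x : residue_field) : residue_field :=
  projT1 (cid (residue_inv_ex x)).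

Fact residue_mulVf x : x != 0 -> residue_inv x * x = 1.
Proof. by rewrite /residue_inv; case: cid => y []. Qed.
Fact residue_inv0 : residue_inv 0 = 0.
Proof. by rewrite /residue_inv; case: cid => y /= [_ y0]; exact: y0. Qed.

HB.instance Definition _ :=
  GRing.ComNzRing_isField.Build residue_field residue_mulVf residue_inv0.

End ResidueField.

Section Resolutions.
Variable R : comNzRingType.

Definition lower (rk : nat -> nat) (i : nat) : nat :=
  if i is j.+1 then rk j else 0%N.

(* A resolution of M by finitely generated free modules F_i = 'rV[R]_(rk i).
   The differential F_i -> F_(i-1) is right multiplication by [dif i], where
   F_(-1) = 0, so that [dif 0] is the (empty) zero map. *)
Record free_resolution (M : lmodType R) := FreeResolution {
  rk : nat -> nat;
  dif : forall i, 'M[R]_(rk i, lower rk i);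
  aug : {linear 'rV[R]_(rk 0) -> M};
  aug_surj : forall y, exists x, aug x = y;
  aug_exact : forall x,
    aug x = 0 <-> exists z : 'rV[R]_(rk 1), x = z *m dif 1;
  dif_exact : forall i (x : 'rV[R]_(rk i.+1)),
    x *m dif i.+1 = 0 <-> exists z : 'rV[R]_(rk i.+2), x = z *m dif i.+2 }.

Variables (m : set R) (M : lmodType R) (F : free_resolution M).

Definition minimal : Prop :=
  forall i (x : 'rV[R]_(rk F i)), (m *s setT) (x *m dif F i).

(* Ext^i_R(M, L) = H^i(Hom_R(F, L)) vanishes. *)
Definition Ext_eq0 (L : lmodType R) (i : nat) : Prop :=
  forall phi : {linear 'rV[R]_(rk F i) -> L},
    (forall x : 'rV[R]_(rk F i.+1), phi (x *m dif F i.+1) = 0) ->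
  exists psi : {linear 'rV[R]_(lower (rk F) i) -> L},
    forall x, phi x = psi (x *m dif F i).

(* The differential of F (x) k is the reduction modulo m of that of F. *)
Definition Tor_dif (hm : maximal_ideal m) (i : nat) :
    'M[residue_field hm]_(rk F i, lower (rk F) i) :=
  map_mx (residue hm) (dif F i).

(* b_i(M) = dim_k H_i(F (x) k), cycles modulo boundaries; the subtraction is
   not truncated since boundaries are cycles. *)
Definition betti (hm : maximal_ideal m) (i : nat) : nat :=
  (\rank (kermx (Tor_dif hm i)) - \rank (Tor_dif hm i.+1))%N.

Definition filt (p : int) (n : nat) : set 'rV[R]_n := ideal_expz m p *s setT.

(* Representatives in m^(j-i) F_i of the cycles and of the boundaries of
   gr_m(F)^j in homological degree i, whose i-th term is
   m^(j-i) F_i / m^(j-i+1) F_i. *)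
Definition gr_cycle (j : int) (i : nat) : set 'rV[R]_(rk F i) :=
  [set x | filt (j - i%:Z) x /\ filt (j - i%:Z + 2) (x *m dif F i)].

Definition gr_boundary (j : int) (i : nat) : set 'rV[R]_(rk F i) :=
  [set x | exists (y : 'rV[R]_(rk F i.+1)) (z : 'rV[R]_(rk F i)),
     [/\ filt (j - i.+1%:Z) y, filt (j - i%:Z + 1) z
       & x = y *m dif F i.+1 + z]].

Definition gr_homology_eq0 (i : nat) : Prop :=
  forall j : int, @gr_cycle j i `<=` @gr_boundary j i.

Definition is_linearity_defect (n : nat) : Prop :=
  (forall i, (n <= i)%N -> gr_homology_eq0 i) /\
  (forall p, (forall i, (p <= i)%N -> gr_homology_eq0 i) -> (n <= p)%N).

Definition eventually_linear : Prop :=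
  exists n, (0 < n)%N /\ is_linearity_defect n.

End Resolutions.

Definition exponential_growth (K : realType) (u : nat -> nat) (a : K) : Prop :=
  1 < a /\ exists (beta : K) (rho : nat -> K),
    [/\ 0 < beta, (fun i => rho i / a ^+ i) @ \oo --> (0 : K)
      & \forall i \near \oo,
          beta * a ^+ i - rho i <= (u i)%:R <= beta * a ^+ i + rho i].

(* Main.v *)
(* Write l_q for the length of m^q and b_n for the n-th Betti number of M, and
   let N_n and C_n be the images of d_n and of its dual. Linearity gives
   N_n ∩ m^2 F = m N_n and m^3 F = m^2 N_n; counting lengths yields the recursion
   b_(n+3) - e b_(n+2) + h_2 b_(n+1) - h_3 b_n = 0, with (1, e, h_2, h_3) the
   Hilbert function of R, so that a and b are roots of
   p(x) = x^3 - e x^2 + h_2 x - h_3. The vanishing of Ext gives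
   C_n ∩ m^2 F^* = m C_n, whence a^3 p(1/a) <= 0.

   Suppose a < b and let c = e - a - b be the third root. The length y(n,p) of
   Hom(M_n, N_p^* ), for syzygies M_n of M and N_p of N, is such that
   l_0 y(n,p) - length(M_n^* ) length(N_p^* ) depends on n + p only, hence is
   O(a^(n+p)), which is negligible against a^n b^p as p grows. Since
   Hom(M_n, N_p^* ) contains m^3 Hom(F_n, G_p^* ), this yields
   h_3 (1 + a)(1 + b) <= l_0 = (1 + a)(1 + b)(1 + c), that is abc <= 1 + c.
   With ac >= 1, which is a^3 p(1/a) <= 0, one gets h_3 = abc >= 2, hence c >= 1
   and 0 <= (a-1)(b-1)(c-1) = -p(1) < 1. So c = 1 and ab = 2, and then
   a + b = e - 1 is an integer strictly between 2 and 3. *)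
Require Import Defs.
From HB Require Import structures.
From mathcomp Require Import all_boot all_order all_algebra.
From mathcomp Require Import boolp classical_sets filter reals.
From mathcomp Require Import topology normedtype sequences.
From mathcomp Require Import zify ring lra.

Set Implicit Arguments.
Unset Strict Implicit.
Unset Printing Implicit Defensive.

Import Order.TTheory GRing.Theory Num.Theory.
Import numFieldNormedType.Exports.

Local Open Scope classical_set_scope.
Local Open Scope ring_scope.

(** * Length *)

Section Submodules.
Variables (R : comNzRingType) (V W : lmodType R).
Implicit Types (S T : set V) (f : {linear V -> W}).

Lemma submoduleN S x : submodule S -> S x -> S (- x).
Proof. by case=> _ _ SZ Sx; rewrite -scaleN1r; exact: SZ. Qed.

Lemma submoduleB S x y : submodule S -> S x -> S y -> S (x - y).
Proof.
by move=> smS Sx Sy; case: (smS) => _ SD _; apply: SD => //; apply: submoduleN.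
Qed.

Lemma submodule_sum S (I : eqType) (r : seq I) (F : I -> V) :
  submodule S -> (forall i, i \in r -> S (F i)) -> S (\sum_(i <- r) F i).
Proof.
case=> S0 SD _ SF; rewrite big_seq; elim/big_ind : _ => //.
Qed.

Lemma submoduleT : submodule [set: V].
Proof. by []. Qed.

Lemma submodule0 : submodule [set (0 : V)].
Proof.
by split=> // [x y -> ->|r x ->] /=; rewrite ?addr0 ?scaler0.
Qed.

Lemma submoduleI S T : submodule S -> submodule T -> submodule (S `&` T).
Proof.
case=> S0 SD SZ [T0 TD TZ]; split=> // [x y [? ?] [? ?]|r x [? ?]].
  by split; [exact: SD|exact: TD].
by split; [exact: SZ|exact: TZ].
Qed.

Definition sum_set S T := [set x | exists2 u, S u & exists2 v, T v & x = u + v].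

Lemma submodule_sum_set S T :
  submodule S -> submodule T -> submodule (sum_set S T).
Proof.
case=> S0 SD SZ [T0 TD TZ]; split.
- by exists 0 => //; exists 0 => //; rewrite addr0.
- move=> _ _ [u Su [v Tv ->]] [u' Su' [v' Tv' ->]].
  by exists (u + u'); [exact: SD|exists (v + v'); [exact: TD|rewrite addrACA]].
- move=> r _ [u Su [v Tv ->]]; exists (r *: u); first exact: SZ.
  by exists (r *: v); [exact: TZ|rewrite scalerDr].
Qed.

Definition ker f : set V := [set x | f x = 0].

Lemma submodule_preimage f (U : set W) : submodule U -> submodule (f @^-1` U).
Proof.
case=> U0 UD UZ; split=> [|x y Ux Uy|r x Ux] /=.
- by rewrite linear0.
- by rewrite linearD; exact: UD.
- by rewrite linearZ; exact: UZ.
Qed.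

Lemma submodule_ker f : submodule (ker f).
Proof.
split=> [|x y fx fy|r x fx]; rewrite /ker /=.
- by rewrite linear0.
- by rewrite linearD fx fy addr0.
- by rewrite linearZ /= fx scaler0.
Qed.

Lemma submodule_image f S : submodule S -> submodule (f @` S).
Proof.
case=> S0 SD SZ; split.
- by exists 0 => //; rewrite linear0.
- move=> _ _ [x Sx <-] [y Sy <-]; exists (x + y); first exact: SD.
  by rewrite linearD.
- by move=> r _ [x Sx <-]; exists (r *: x); [exact: SZ|rewrite linearZ].
Qed.

End Submodules.

(* [chain k S]: there is a strictly increasing chain of k + 1 submodules that
   ends at S. *)
Fixpoint chain (R : comNzRingType) (V : lmodType R) (k : nat) (S : set V) :
    Prop :=
  if k is k'.+1 then
    exists T, [/\ submodule T, T `<=` S, T <> S & chain k' T]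
  else True.

Definition has_length (R : comNzRingType) (V : lmodType R) (S : set V) k :=
  chain k S /\ forall j, chain j S -> (j <= k)%N.

Definition finite_length (R : comNzRingType) (V : lmodType R) (S : set V) :=
  exists k, has_length S k.

(** The default value 0 is taken when S does not have finite length. *)
Definition len (R : comNzRingType) (V : lmodType R) (S : set V) : nat :=
  xget 0%N (has_length S).

(** * Additivity of length along linear maps *)

Section Chains.
Variable (R : comNzRingType).
Implicit Types (V W : lmodType R).

Lemma chain_sub V k (S T : set V) : S `<=` T -> chain k S -> chain k T.
Proof.
case: k => //= k ST [U [smU US USneq cU]]; exists U; split=> //.
  exact: subset_trans US ST.
by move=> UT; apply: USneq; apply/seteqP; split=> //; rewrite UT.
Qed.

(** The bound is lowered one unit at a time until some chain attains it. *)
Lemma finite_length_bounded V (S : set V) n :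
  (forall k, chain k S -> (k <= n)%N) -> finite_length S.
Proof.
elim: n => [|n IHn] bS; first by exists 0%N.
have [cn|ncn] := pselect (chain n.+1 S); first by exists n.+1.
apply: IHn => k ck; have := bS _ ck; rewrite leq_eqVlt => /predU1P[kn|//].
by rewrite kn in ck.
Qed.

Lemma has_length_len V (S : set V) : finite_length S -> has_length S (len S).
Proof. by move=> [k Sk]; exact: (xgetPex 0%N (ex_intro _ k Sk)). Qed.

Lemma has_lengthE V (S : set V) k : has_length S k -> len S = k.
Proof.
move=> Sk; have [c1 m1] := has_length_len (ex_intro _ k Sk).
by case: Sk => c2 m2; apply/eqP; rewrite eqn_leq m1 // m2.
Qed.

Lemma finite_length_sub V (S T : set V) :
  S `<=` T -> finite_length T -> finite_length S.
Proof.
move=> ST [k [_ mk]]; apply: (@finite_length_bounded _ _ k) => j cj.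
exact/mk/(chain_sub ST).
Qed.

Lemma len_sub V (S T : set V) :
  S `<=` T -> finite_length T -> (len S <= len T)%N.
Proof.
move=> ST fT; have [cS _] := has_length_len (finite_length_sub ST fT).
have [_ mT] := has_length_len fT.
exact/mT/(chain_sub ST).
Qed.

Lemma has_length0 V : has_length [set (0 : V)] 0.
Proof.
split=> // -[//|j] /= [T [[T0 _ _] Ts Tneq _]].
by case: Tneq; apply/seteqP; split=> // x ->.
Qed.

(** If T is a proper submodule of S, then T and S cannot have both the same intersection with the
    kernel and the same image, so each step of the chain stays strict on at least one side. *)
Lemma chain_split V W (f : {linear V -> W}) k (S : set V) :
  submodule S -> chain k S ->
  exists i j, [/\ k = (i + j)%N, chain i (S `&` ker f) & chain j (f @` S)].
Proof.
elim: k S => [|k IHk] S smS /=; first by exists 0%N, 0%N.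
move=> [T [smT TS TSneq /(IHk _ smT)[i [j [-> ci cj]]]]].
have TfSf : f @` T `<=` f @` S by exact: image_subset.
have [TkSk|/eqP TkSk] := eqVneq (T `&` ker f) (S `&` ker f); last first.
  exists i.+1, j; split=> //; last exact: chain_sub cj.
  exists (T `&` ker f); split=> //.
  - exact: submoduleI (submodule_ker _).
  - exact: setSI.
exists i, j.+1; split; [by rewrite addnS|by rewrite -TkSk|].
exists (f @` T); split=> //; first exact: submodule_image.
move=> TfSfe; apply: TSneq; apply/seteqP; split=> // x Sx.
have [y Ty fyx] : (f @` T) (f x) by rewrite TfSfe; exists x.
have : (T `&` ker f) (x - y).
  rewrite TkSk; split; first by apply: submoduleB => //; exact: TS.
  by rewrite /ker /= linearB /= fyx subrr.
move=> [Txy _]; rewrite -(subrK y x); case: smT => _ TD _; exact: TD.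
Qed.

(** The chain in the image is pulled back to S and stacked on top of the chain in the kernel. *)
Lemma chain_join V W (f : {linear V -> W}) i j (S : set V) :
  submodule S -> chain i (S `&` ker f) -> chain j (f @` S) -> chain (i + j) S.
Proof.
elim: j S => [|j IHj] S smS ci.
  by move=> _; rewrite addn0; apply: chain_sub ci => x [].
move=> [U [smU US USneq cU]]; rewrite addnS.
have fSU : f @` (S `&` f @^-1` U) = U.
  apply/seteqP; split=> [_ [x [_ Ux] <-] //|u Uu].
  by have [x Sx xu] := US _ Uu; exists x => //; split=> //=; rewrite xu.
exists (S `&` f @^-1` U); split.
- exact: submoduleI (submodule_preimage _ _).
- by move=> x [].
- by move=> SU; apply: USneq; rewrite -fSU SU.
- apply: IHj; [exact: submoduleI (submodule_preimage _ _)| |by rewrite fSU].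
  apply: chain_sub ci => x [Sx kx]; split=> //; split=> //=.
  by rewrite kx; case: smU.
Qed.

Lemma has_length_linear V W (f : {linear V -> W}) i j (S : set V) :
  submodule S -> has_length (S `&` ker f) i -> has_length (f @` S) j ->
  has_length S (i + j).
Proof.
move=> smS [ci mi] [cj mj]; split; first exact: (chain_join smS ci cj).
move=> k /(chain_split f smS)[i' [j' [-> ci' cj']]].
by rewrite leq_add ?mi ?mj.
Qed.

Lemma finite_length_image V W (f : {linear V -> W}) (S : set V) :
  submodule S -> finite_length S -> finite_length (f @` S).
Proof.
move=> smS [k [_ mk]]; apply: (@finite_length_bounded _ _ k) => j cj.
by apply: mk; rewrite -[j]add0n; exact: (chain_join smS _ cj).
Qed.

Lemma len_linear V W (f : {linear V -> W}) (S : set V) :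
  submodule S -> finite_length S ->
  len S = (len (S `&` ker f) + len (f @` S))%N.
Proof.
move=> smS fS; apply: has_lengthE; apply: (has_length_linear smS).
  by apply: has_length_len; apply: finite_length_sub fS => x [].
by apply: has_length_len; exact: finite_length_image.
Qed.

Lemma len_linear_inj V W (f : {linear V -> W}) (S : set V) :
  submodule S -> finite_length S -> (forall x, f x = 0 -> x = 0) ->
  len (f @` S) = len S.
Proof.
move=> smS fS finj; rewrite (len_linear f smS fS).
suff -> : S `&` ker f = [set 0] by rewrite (has_lengthE (has_length0 _)).
apply/seteqP; split=> [x [_ /finj]//|x ->]; split; first by case: smS.
by rewrite /ker /= linear0.
Qed.

(** Let T be the term just below B in the chain. If T contains A, then T = A. Otherwise T ∩ A is
    proper in A, and T / (T ∩ A), isomorphic to (T + A) / A, again has no intermediate submodule, so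
    induction applies to T ∩ A inside T. *)
Lemma chain_simple V k (A B : set V) :
  submodule A -> submodule B -> A `<=` B ->
  (forall C, submodule C -> A `<=` C -> C `<=` B -> C = A \/ C = B) ->
  chain k.+1 B -> chain k A.
Proof.
elim: k A B => [//|k IHk] A B smA smB AB simAB [T [smT TB TBneq cT]].
have [AT|nAT] := pselect (A `<=` T).
  by case: (simAB T smT AT TB) => // <-.
exists (T `&` A); split; first exact: submoduleI.
- by move=> x [].
- by move=> TA; apply: nAT => x; rewrite -TA => -[].
have smTA := submoduleI smT smA.
apply: (IHk _ T) => //.
move=> C smC TAC CT.
have [smC0 smCD _] := smC; have [smA0 smAD _] := smA; have [_ smBD _] := smB.
(* C is tested through C + A, from which it is recovered by the modular law. *)
case: (simAB (sum_set C A)).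
- exact: submodule_sum_set.
- by move=> x Ax; exists 0 => //; exists x => //; rewrite add0r.
- move=> _ [u Cu [v Av ->]]; apply: smBD; last exact: AB.
  exact/TB/CT.
- move=> CAA; left; apply/seteqP; split=> // x Cx; split; first exact: CT.
  by rewrite -CAA; exists x => //; exists 0 => //; rewrite addr0.
- move=> CAB; right; apply/seteqP; split=> // x Tx.
  have [u Cu [v Av xuv]] : sum_set C A x by rewrite CAB; exact: TB.
  rewrite xuv; apply: smCD => //; apply: TAC; split=> //.
  by rewrite -[v](addKr u) -xuv addrC; apply: submoduleB => //; exact: CT.
Qed.

Lemma has_length_simple V k (A B : set V) :
  submodule A -> submodule B -> A `<=` B -> A <> B ->
  (forall C, submodule C -> A `<=` C -> C `<=` B -> C = A \/ C = B) ->
  has_length A k -> has_length B k.+1.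
Proof.
move=> smA smB AB ABneq simAB [cA mA]; split; first by exists A.
by move=> [//|j] /(chain_simple smA smB AB simAB) /mA.
Qed.

End Chains.

(** * Powers of an ideal *)

Section Ideals.
Variable R : comNzRingType.

Lemma submodule_smul (V : lmodType R) (I : set R) (S : set V) :
  ideal I -> submodule (I *s S).
Proof.
case=> I0 _ IZ; split.
- by exists [::]; rewrite big_nil.
- move=> _ _ [s [sP ->]] [t [tP ->]]; exists (s ++ t); split.
    by move=> p; rewrite mem_cat => /orP[/sP|/tP].
  by rewrite big_cat.
- move=> r _ [s [sP ->]].
  exists [seq (r * p.1, p.2) | p <- s]; split.
    by move=> _ /mapP[p /sP[Ip Sp] ->]; split=> //; exact: IZ.
  by rewrite big_map scaler_sumr; apply: eq_bigr => p _; rewrite scalerA.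
Qed.

Lemma ideal_ideal_exp (m : set R) q : ideal m -> ideal (ideal_exp m q).
Proof. by move=> mI; case: q => [//|q]; exact: submodule_smul. Qed.

Lemma ideal_exp_mul (m : set R) p q x y : ideal m ->
  ideal_exp m p x -> ideal_exp m q y -> ideal_exp m (p + q) (x * y).
Proof.
move=> mI; elim: p x y => [|p IHp] x y.
  by move=> _ my; rewrite add0n; case: (ideal_ideal_exp q mI) => _ _; apply.
move=> [s [sP ->]] my; rewrite addSn mulr_suml.
apply: (@submodule_sum R R^o (ideal_exp m (p + q).+1)).
  exact: ideal_ideal_exp.
move=> t /sP[mt mpt]; exists [:: (t.1, t.2 * y)]; split.
  by move=> u; rewrite inE => /eqP -> /=; split=> //; exact: IHp.
by rewrite big_seq1 /GRing.scale /= mulrA.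
Qed.

Lemma ideal_exp1 (m : set R) x : m x -> ideal_exp m 1 x.
Proof.
move=> mx; exists [:: (x, 1)]; split.
  by move=> u; rewrite inE => /eqP -> /=.
by rewrite big_seq1 /GRing.scale /= mulr1.
Qed.

Lemma ideal_exp1E (m : set R) : ideal m -> ideal_exp m 1 = m.
Proof.
move=> mI; apply/seteqP; split=> [x [s [sP ->]]|x]; last exact: ideal_exp1.
apply: (@submodule_sum R R^o m) => // t /sP[mt _]; rewrite [_ *: _]mulrC.
by case: mI => _ _; apply.
Qed.

Lemma ideal_expS (m : set R) p x : ideal m ->
  ideal_exp m p.+1 x -> ideal_exp m p x.
Proof.
move=> mI [s [sP ->]]; have mpI := ideal_ideal_exp p mI.
apply: (@submodule_sum R R^o (ideal_exp m p)) => // t /sP[_].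
by case: mpI => _ _; apply.
Qed.

Lemma ideal_exp_le (m : set R) p q x : ideal m -> (p <= q)%N ->
  ideal_exp m q x -> ideal_exp m p x.
Proof.
move=> mI /subnKC <-; elim: (q - p)%N => [|k IHk]; first by rewrite addn0.
by rewrite addnS => /(ideal_expS mI).
Qed.

End Ideals.

(** * Finite length of the powers of the maximal ideal *)

Section ArtinianLength.
Variables (R : comNzRingType) (m : set R).
Hypothesis maxm : maximal_ideal m.

Lemma maximal_idealP r : ~ m r -> exists u s, m u /\ 1 = u + s * r.
Proof.
have [mI mT mmax] := maxm; move=> nmr.
have IR : ideal (sum_set (m : set R^o) [set s * r | s in [set: R]]).
  apply: submodule_sum_set => //; split.
  - by exists 0 => //; rewrite mul0r.
  - by move=> _ _ [x _ <-] [y _ <-]; exists (x + y) => //; rewrite mulrDl.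
  - by move=> c _ [x _ <-]; exists (c * x) => //; rewrite -mulrA.
have [m0 _ _] := mI.
case: (mmax _ IR).
- move=> x mx; exists x => //; exists 0; last by rewrite addr0.
  by exists 0 => //; rewrite mul0r.
- move=> Im; case: nmr; rewrite -Im; exists 0 => //.
  by exists r; [exists 1 => //; rewrite mul1r|rewrite add0r].
- move=> IT; have [u mu [_ [s _ <-] e1]] :
    sum_set (m : set R^o) [set s * r | s in [set: R]] 1 by rewrite IT.
  by exists u, s.
Qed.

(** Generators are added one at a time: since m x lies in A, the quotient (A + R x) / A is zero or
    simple. *)
Lemma finite_length_span (V : lmodType R) (A : set V) (s : seq V) :
  submodule A -> finite_length A ->
  (forall x u, x \in s -> m u -> A (u *: x)) ->
  finite_length (sum_set A (setT *s [set` s])).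
Proof.
elim: s A => [|x s IHs] A smA fA sA.
  suff -> : sum_set A (setT *s [set` [::]]) = A by [].
  apply/seteqP; split=> [_ [u Au [_ [t [tP ->]] ->]]|u Au].
    case: t tP => [|p t] tP; first by rewrite big_nil addr0.
    by have [] := tP p (mem_head _ _).
  exists u => //; exists 0; last by rewrite addr0.
  by exists [::]; rewrite big_nil.
have [A0 AD AZ] := smA.
pose B := sum_set A [set r *: x | r in [set: R]].
have smB : submodule B.
  apply: submodule_sum_set => //; split.
  - by exists 0 => //; rewrite scale0r.
  - by move=> _ _ [a _ <-] [b _ <-]; exists (a + b) => //; rewrite scalerDl.
  - by move=> c _ [a _ <-]; exists (c * a) => //; rewrite scalerA.
have AB : A `<=` B.
  move=> u Au; exists u => //; exists 0; last by rewrite addr0.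
  by exists 0 => //; rewrite scale0r.
have fB : finite_length B.
  have [<-//|/eqP ABneq] := eqVneq A B.
  have [k Ak] := fA; exists k.+1; apply: (has_length_simple smA) => // C smC AC CB.
  have [CA|nCA] := pselect (C `<=` A); first by left; apply/seteqP.
  right; apply/seteqP; split=> //.
  have [y [Cy nAy]] : exists y, C y /\ ~ A y.
    apply: contrapT => nex; apply: nCA => y Cy; apply: contrapT => nAy.
    by apply: nex; exists y.
  have [u Au [_ [r _ <-] yE]] := CB _ Cy.
  have nmr : ~ m r.
    move=> mr; apply: nAy; rewrite yE; apply: AD => //.
    by apply: sA => //; exact: mem_head.
  (* Writing 1 = v + t r gives x = v x + t (y - u), and both summands lie in C. *)
  have [v [t [mv e1]]] := maximal_idealP nmr.
  have [_ CD CZ] := smC.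
  have Cx : C x.
    rewrite -(scale1r x) e1 scalerDl -scalerA; apply: CD.
      by apply: AC; apply: sA => //; exact: mem_head.
    apply: CZ; have -> : r *: x = y - u by rewrite yE addrAC subrr add0r.
    by apply: submoduleB => //; exact: AC.
  move=> _ [w Aw [_ [c _ <-] ->]]; apply: CD; first exact: AC.
  exact: CZ.
apply: finite_length_sub (IHs B smB fB _).
  move=> _ [u Au [_ [t [tP ->]] ->]].
  elim: t u Au tP => [|[c y] t IHt] u Au tP.
    rewrite big_nil addr0; exists u; first exact: AB.
    by exists 0; [exists [::]; rewrite big_nil|rewrite addr0].
  have := tP (c, y) (mem_head _ _); rewrite /= inE => -[_ ys].
  have {IHt}[w Bw [z Sz e]] : sum_set B (setT *s [set` s])
      (u + \sum_(p <- t) p.1 *: p.2).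
    by apply: IHt => // p pt; apply: tP; rewrite inE pt orbT.
  have [_ BD _] := smB; rewrite big_cons /= addrCA e.
  case/predU1P: ys => [->|ys].
    exists (c *: x + w); last by exists z => //; rewrite addrA.
    apply: BD => //; exists 0 => //; exists (c *: x); last by rewrite add0r.
    by exists c.
  exists w => //; exists (c *: y + z); last by rewrite addrCA.
  case: Sz => q [qP ->]; exists ((c, y) :: q); split; last by rewrite big_cons.
  by move=> p; rewrite inE => /predU1P[->//|/qP].
move=> y u ys mu; apply: AB; apply: sA => //.
by rewrite inE ys orbT.
Qed.

Hypothesis noethR : noetherian R.
Variable n : nat.
Hypothesis mn0 : ideal_exp m n = [set 0].

(** Descending induction from m^n = 0: by noetherianity m^p is spanned by finitely many elements,
    and m multiplies each of them into m^(p+1). *)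
Lemma finite_length_ideal_exp q :
  finite_length (ideal_exp m q : set R^o).
Proof.
have [mI _ _] := maxm.
have [nq|qn] := leqP n q.
  apply: (finite_length_sub _ (ex_intro _ _ (has_length0 R^o))) => x.
  by move=> /(ideal_exp_le mI nq); rewrite mn0.
rewrite -(subKn (ltnW qn)); elim: (n - q)%N => [|k IHk].
  rewrite subn0 mn0; exact: (ex_intro _ _ (has_length0 R^o)).
have [nk|kn] := leqP n k.
  by move: IHk; have -> : (n - k = n - k.+1)%N by lia.
have e : (n - k = (n - k.+1).+1)%N by lia.
rewrite e in IHk; set p := (n - k.+1)%N in IHk *.
have [s sE] := noethR (ideal_ideal_exp p mI).
apply: finite_length_sub (finite_length_span _ IHk (s := s) _).
- move=> x mx; exists 0; first by case: (ideal_ideal_exp p.+1 mI).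
  by exists x; [rewrite -sE|rewrite add0r].
- exact: (ideal_ideal_exp p.+1 mI).
- move=> x u xs mu; exists [:: (u, x)]; split; last by rewrite big_seq1.
  move=> _ /[!inE] /eqP ->; split=> //=; rewrite sE.
  exists [:: (1, x)]; split; last by rewrite big_seq1 scale1r.
  by move=> _ /[!inE] /eqP ->.
Qed.

Lemma len_ring :
  len ([set: R] : set R^o) = (len (ideal_exp m 1 : set R^o)).+1.
Proof.
have [mI mT mmax] := maxm; rewrite ideal_exp1E //.
apply: has_lengthE; apply: (@has_length_simple _ R^o _ m) => //.
- by move=> C CI mC _; exact: mmax.
- by have := finite_length_ideal_exp 1; rewrite ideal_exp1E // => /has_length_len.
Qed.

End ArtinianLength.

(** * Length of modules of matrices *)

Section MatrixLength.
Variable R : comNzRingType.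

Definition entries_in (I : set R) p n : set 'M[R]_(p, n) :=
  [set A | forall i j, I (A i j)].

Definition cols_in p (S : set 'cV[R]_p) n : set 'M[R]_(p, n) :=
  [set A | forall j, S (col j A)].

Arguments entries_in : clear implicits.
Arguments cols_in {p} S n.

Lemma submodule_cols_in p (S : set 'cV[R]_p) n :
  submodule S -> submodule (cols_in S n).
Proof.
case=> S0 SD SZ; split=> [j|A B SA SB j|r A SA j].
- by rewrite linear0.
- by rewrite linearD; apply: SD; [exact: SA|exact: SB].
- have -> : col j (r *: A) = r *: col j A by apply/matrixP=> ? ?; rewrite !mxE.
  exact/SZ/SA.
Qed.

Lemma submodule_entries_in (I : set R) p n :
  ideal I -> submodule (entries_in I p n).
Proof.
case=> I0 ID IZ; split=> [i j|A B IA IB i j|r A IA i j]; rewrite !mxE //.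
  by apply: ID; [exact: IA|exact: IB].
exact/IZ/IA.
Qed.

(** Induction on the number of columns: [f] drops the first column, and [g] identifies the kernel of
    [f] with S. *)
Lemma has_length_cols_in p (S : set 'cV[R]_p) n k :
  submodule S -> has_length S k -> has_length (cols_in S n) (n * k).
Proof.
move=> smS Sk; elim: n => [|n IHn].
  rewrite mul0n; suff -> : cols_in S 0 = [set 0] by exact: has_length0.
  apply/seteqP; split=> [A _|_ -> []//]; exact: thinmx0.
rewrite mulSn -[n.+1]/(1 + n)%N.
pose f : {linear 'M[R]_(p, 1 + n) -> 'M[R]_(p, n)} := @rsubmx R p 1 n.
pose g : {linear 'M[R]_(p, 1 + n) -> 'M[R]_(p, 1)} := @lsubmx R p 1 n.
have smC := submodule_cols_in (1 + n) smS.
have gE A : g A = col (lshift n (0 : 'I_1)) A.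
  by apply/matrixP => i j; rewrite !mxE ord1.
have S0 : S 0 by case: smS.
apply: (has_length_linear (f := f) smC).
- rewrite -[k]add0n.
  apply: (has_length_linear (f := g) (submoduleI smC (submodule_ker f))).
    suff -> : cols_in S (1 + n) `&` ker f `&` ker g = [set 0].
      exact: has_length0.
    apply/seteqP; split=> [A [[_ kf] kg]|_ ->].
      have := @hsubmxK _ p 1 n A.
      rewrite (kf : @rsubmx R p 1 n A = 0) (kg : @lsubmx R p 1 n A = 0).
      by rewrite row_mx0 => <-.
    by split; [split=> [j|]|]; rewrite /ker /= linear0.
  suff -> : g @` (cols_in S (1 + n) `&` ker f) = S by [].
  apply/seteqP; split=> [_ [A [SA _] <-]|v Sv]; first by rewrite gE; exact: SA.
  exists (row_mx v 0); last exact: row_mxKl.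
  split; last exact: row_mxKr.
  move=> j; case: (@split_ordP 1 n j) => {}j ->.
    rewrite colKl; suff -> : col j v = v by [].
    by apply/matrixP=> i l; rewrite mxE !ord1.
  by rewrite colKr linear0.
suff -> : f @` (cols_in S (1 + n)) = cols_in S n by [].
apply/seteqP; split=> [_ [A SA <-] j|B SB].
  suff -> : col j (f A) = col (rshift 1 j) A by exact: SA.
  by apply/matrixP=> i l; rewrite !mxE.
exists (row_mx 0 B); last exact: row_mxKr.
move=> j; case: (@split_ordP 1 n j) => {}j ->; first by rewrite colKl linear0.
by rewrite colKr; exact: SB.
Qed.

Lemma has_length_trmx p n (S : set 'M[R]_(p, n)) k :
  submodule S -> has_length (trmx @` S) k -> has_length S k.
Proof.
move=> smS Sk; rewrite -[k]add0n.
apply: (has_length_linear (f := trmx) smS) => //.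
suff -> : S `&` ker trmx = [set 0] by exact: has_length0.
apply/seteqP; split=> [A [_ kA]|_ ->].
  by rewrite /= -(trmxK A) (kA : A^T = 0) linear0.
by split; [case: smS|rewrite /ker /= linear0].
Qed.

(** The 1 x 1 case gives single columns by transposition, and these give all matrices column by
    column. *)
Lemma has_length_entries_in (I : set R) p n k :
  ideal I -> has_length (I : set R^o) k ->
  has_length (entries_in I p n) (p * n * k).
Proof.
move=> iI Ik; have I0 : I 0 by case: iI.
have E11 : has_length (entries_in I 1 1) k.
  pose f (A : 'M[R]_(1, 1)) : R^o := A 0 0.
  have lf : linear f by move=> a A B; rewrite /f !mxE.
  pose F : {linear 'M[R]_(1, 1) -> R^o} :=
    HB.pack f (GRing.isLinear.Build _ _ _ _ f lf).
  rewrite -[k]add0n.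
  apply: (has_length_linear (f := F) (submodule_entries_in 1 1 iI)).
    suff -> : entries_in I 1 1 `&` ker F = [set 0] by exact: has_length0.
    apply/seteqP; split=> [A [_ kA]|_ ->].
      by apply/matrixP=> i j; rewrite !ord1 mxE; exact: kA.
    by split; [move=> i j|rewrite /ker /= /f]; rewrite mxE.
  suff -> : F @` (entries_in I 1 1) = I by [].
  apply/seteqP; split=> [_ [A IA <-]|x Ix]; first exact: IA.
  by exists (const_mx x) => [i j|]; rewrite /= /f mxE.
have E1 q : has_length (entries_in I q 1) (q * k).
  apply: has_length_trmx; first exact: submodule_entries_in.
  suff -> : trmx @` (entries_in I q 1) = cols_in (entries_in I 1 1) q.
    exact/has_length_cols_in/E11/submodule_entries_in.
  apply/seteqP; split=> [_ [A IA <-] j i l|B IB].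
    by rewrite !mxE; exact: IA.
  exists B^T; last exact: trmxK.
  by move=> i j; have := IB i j 0; rewrite !mxE.
rewrite mulnC mulnA [(k * p)%N]mulnC mulnC.
suff -> : entries_in I p n = cols_in (entries_in I p 1) n.
  exact/has_length_cols_in/E1/submodule_entries_in.
apply/seteqP; split=> A IA => [j i l|i j]; first by rewrite mxE; exact: IA.
by have := IA j i 0; rewrite mxE.
Qed.

End MatrixLength.

Arguments entries_in {R} I p n.
Arguments cols_in {R p} S n.

(** * Lengths in linear resolutions *)

Section LocalRing.
Variables (R : comNzRingType) (m : set R).
Hypotheses (maxm : maximal_ideal m) (noethR : noetherian R).
Hypotheses (m4 : ideal_exp m 4 = [set 0]) (m3 : ideal_exp m 3 <> [set 0]).

(** As m^4 = 0, the Hilbert function (1, e, h_2, h_3) of R is given by e = [ell 1] - [ell 2], h_2 =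
    [ell 2] - [ell 3] and h_3 = [ell 3]. *)
Definition ell q := len (ideal_exp m q : set R^o).
Definition mxm q p n := entries_in (ideal_exp m q) p n.
Arguments mxm q {p n}.

Let idealm : ideal m. Proof. by case: maxm. Qed.

Lemma submodule_mxm q p n : submodule (@mxm q p n).
Proof. exact/submodule_entries_in/ideal_ideal_exp. Qed.

Lemma has_length_mxm q p n : has_length (@mxm q p n) (p * n * ell q).
Proof.
apply: has_length_entries_in; first exact: ideal_ideal_exp.
exact/has_length_len/(finite_length_ideal_exp maxm noethR m4).
Qed.

Lemma len_mxm q p n : len (@mxm q p n) = (p * n * ell q)%N.
Proof. exact/has_lengthE/has_length_mxm. Qed.

Lemma mxm0E p n : @mxm 0 p n = setT.
Proof. by apply/seteqP. Qed.

Lemma mxm_ge4 q p n (A : 'M[R]_(p, n)) : (4 <= q)%N -> mxm q A -> A = 0.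
Proof.
move=> q4 mA; apply/matrixP => i j; rewrite mxE.
by have := ideal_exp_le idealm q4 (mA i j); rewrite m4.
Qed.

Lemma mxm_le p q r n (A : 'M[R]_(r, n)) : (p <= q)%N -> mxm q A -> mxm p A.
Proof. by move=> pq mA i j; exact: ideal_exp_le pq (mA i j). Qed.

Lemma mxm_mul p q r s t (A : 'M[R]_(r, s)) (B : 'M[R]_(s, t)) :
  mxm p A -> mxm q B -> mxm (p + q) (A *m B).
Proof.
move=> mA mB i j; rewrite mxE.
apply: (@submodule_sum R R^o (ideal_exp m (p + q))) => [|k _].
  exact: ideal_ideal_exp.
exact: ideal_exp_mul.
Qed.

Lemma finite_length_mx p n (S : set 'M[R]_(p, n)) : finite_length S.
Proof.
apply: (@finite_length_sub _ _ _ (@mxm 0 p n)); first by rewrite mxm0E.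
exact: ex_intro _ _ (has_length_mxm 0 p n).
Qed.

Lemma len_mx p n : len [set: 'M[R]_(p, n)] = (p * n * ell 0)%N.
Proof. by rewrite -mxm0E len_mxm. Qed.

Lemma len_mulmx p q n (A : 'M[R]_(p, q)) (S : set 'M[R]_(q, n)) :
  submodule S ->
  len S = (len (S `&` [set X | A *m X = 0%R]) + len [set A *m X | X in S])%N.
Proof.
by move=> smS; apply: (len_linear (mulmx A)) => //; exact: finite_length_mx.
Qed.

Lemma len_mulmxr p q n (A : 'M[R]_(p, q)) (S : set 'M[R]_(n, p)) :
  submodule S ->
  len S = (len (S `&` [set X | X *m A = 0%R]) + len [set X *m A | X in S])%N.
Proof.
by move=> smS; apply: (len_linear (mulmxr A)) => //; exact: finite_length_mx.
Qed.

Lemma len_cols_in p (S : set 'cV[R]_p) n :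
  submodule S -> len (cols_in S n) = (n * len S)%N.
Proof.
move=> smS; apply/has_lengthE/has_length_cols_in => //.
exact/has_length_len/finite_length_mx.
Qed.

Lemma len_trmx p n (S : set 'M[R]_(p, n)) :
  submodule S -> len (trmx @` S) = len S.
Proof.
move=> smS; apply: (@len_linear_inj _ _ _ trmx) => //; first exact: finite_length_mx.
by move=> A /= A0; rewrite -(trmxK A) A0 linear0.
Qed.

Lemma ell0 : ell 0 = (ell 1).+1.
Proof. by rewrite /ell (len_ring maxm noethR m4). Qed.

Lemma ell3_gt0 : (0 < ell 3)%N.
Proof.
have [_ ml] := has_length_len (finite_length_ideal_exp maxm noethR m4 3).
apply: ml; exists [set 0]; split=> //; first exact: submodule0.
  by move=> _ ->; case: (ideal_ideal_exp 3 idealm).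
by move=> e; case: m3.
Qed.

(* A tail of a minimal free resolution, indexed from 0, whose dual is exact. The
   last two fields are all that is used of the acyclicity of gr_m: the image N of
   d i satisfies N ∩ m^2 F = m N and m^3 F = m^2 N. *)
Record linear_tail (b : nat -> nat) (d : forall i, 'M[R]_(b i.+1, b i)) :
    Prop := LinearTail {
  tail_minimal : forall i, mxm 1 (d i);
  tail_exact : forall i (x : 'rV[R]_(b i.+1)),
    x *m d i = 0 <-> exists y, x = y *m d i.+1;
  tail_dual_exact : forall i (f : 'cV[R]_(b i.+1)),
    d i.+1 *m f = 0 <-> exists g, f = d i *m g;
  tail_linear2 : forall i (x : 'rV[R]_(b i.+1)),
    mxm 2 (x *m d i) -> exists2 y, mxm 1 y & x *m d i = y *m d i;
  tail_linear3 : forall i (x : 'rV[R]_(b i)),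
    mxm 3 x -> exists2 y, mxm 2 y & x = y *m d i }.

Arguments tail_minimal {b d} _ i.

(** * Length counts along one resolution and its dual *)

Section OneTail.
Variables (b : nat -> nat) (d : forall i, 'M[R]_(b i.+1, b i)).
Hypothesis dP : linear_tail d.

Lemma tail_complex i : d i.+1 *m d i = 0.
Proof.
apply/row_matrixP=> k; rewrite row0 row_mul; apply/(tail_exact dP).
by exists (delta_mx 0 k); rewrite -rowE.
Qed.

Lemma tail_dual_exact_mx i q (X : 'M[R]_(b i.+1, q)) :
  d i.+1 *m X = 0 -> exists Y, X = d i *m Y.
Proof.
move=> dX; have /choice[g gE] j : exists g, col j X = d i *m g.
  by apply/(tail_dual_exact dP); rewrite colE mulmxA dX mul0mx.
exists (\matrix_(k, j) g j k 0); apply/matrixP=> k j.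
have /matrixP/(_ k 0) := gE j; rewrite !mxE => ->.
by apply: eq_bigr => l _; rewrite !mxE.
Qed.

Lemma len_dual_kernel i q :
  len [set X : 'M[R]_(b i.+1, q) | d i.+1 *m X = 0] =
  (q * len [set d i *m x | x in [set: 'cV[R]_(b i)]])%N.
Proof.
rewrite -len_cols_in; last exact: (submodule_image (mulmx (d i))).
congr len; apply/seteqP; split=> [X /tail_dual_exact_mx[Y ->] j|X dX].
  by exists (col j Y) => //; rewrite !colE mulmxA.
apply/matrixP=> k j; have [g _ gE] := dX j.
have /matrixP/(_ k 0) : col j (d i.+1 *m X) = 0.
  by rewrite colE -mulmxA -colE -gE mulmxA tail_complex mul0mx.
by rewrite !mxE.
Qed.

Definition rowlen i := len [set x *m d i | x in [set: 'rV[R]_(b i.+1)]].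
(** By dual exactness the columns d_i x form the kernel of d_(i+1), which is the dual of the syzygy
    measured by [rowlen i]. *)
Definition collen i := len [set d i *m x | x in [set: 'cV[R]_(b i)]].

Lemma rowlen_rec i : (rowlen i + rowlen i.+1 = b i.+1 * ell 0)%N.
Proof.
have := len_mulmxr (d i) (@submoduleT _ 'rV[R]_(b i.+1)).
rewrite len_mx mul1n => ->; rewrite addnC; congr (len _ + _)%N.
apply/seteqP; split=> [_ [y _ <-]|x [_ /(tail_exact dP)[y ->]]]; last by exists y.
by split=> //; apply/(tail_exact dP); exists y.
Qed.

Lemma collen_rec i : (collen i + collen i.+1 = b i.+1 * ell 0)%N.
Proof.
have := len_mulmx (d i.+1) (@submoduleT _ 'cV[R]_(b i.+1)).
rewrite len_mx muln1 => ->; congr (len _ + _)%N.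
apply/seteqP; split=> [_ [y _ <-]|x [_ /(tail_dual_exact dP)[y ->]]];
  last by exists y.
by split=> //; apply/(tail_dual_exact dP); exists y.
Qed.

(** Lengths are counted in the exact sequence 0 -> N_(i+2) -> m F_(i+2) -> m^2 F_(i+1) -> m^3 F_i ->
    0, where N_(i+2) is the image of d_(i+2). Exactness at m^2 F_(i+1) is [tail_linear2], and at m^3
    F_i it is [tail_linear3]. *)
Lemma rowlen_linear i :
  (rowlen i.+2 + b i.+1 * ell 2 = b i * ell 3 + b i.+2 * ell 1)%N.
Proof.
have := len_mulmxr (d i) (submodule_mxm 2 1 (b i.+1)).
rewrite len_mxm mul1n.
have -> : [set X *m d i | X in @mxm 2 1 (b i.+1)] = mxm 3.
  apply/seteqP; split=> [_ [x mx <-]|x /(tail_linear3 dP)[y my ->]].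
    exact: (mxm_mul mx (tail_minimal dP i)).
  by exists y.
have -> : mxm 2 `&` [set x | x *m d i = 0] =
    [set x *m d i.+1 | x in @mxm 1 1 (b i.+2)].
  apply/seteqP; split=> [x [mx /(tail_exact dP)[y xE]]|_ [y my <-]].
    move: mx; rewrite xE => /(tail_linear2 dP)[z mz ->].
    by exists z.
  split; first exact: (mxm_mul my (tail_minimal dP _)).
  by apply/(tail_exact dP); exists y.
rewrite len_mxm mul1n.
have := len_mulmxr (d i.+1) (submodule_mxm 1 1 (b i.+2)).
rewrite len_mxm mul1n.
have -> : mxm 1 `&` [set x | x *m d i.+1 = 0] =
    [set x *m d i.+2 | x in [set: 'rV[R]_(b i.+3)]].
  apply/seteqP; split=> [x [mx /(tail_exact dP)[y ->]]|_ [y _ <-]].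
    by exists y.
  split; last by apply/(tail_exact dP); exists y.
  by apply: (@mxm_mul 0 1); [rewrite mxm0E|exact: (tail_minimal dP _)].
by rewrite -/(rowlen i.+2); lia.
Qed.

(* If psi had a unit entry psi_i, then u psi_i would lie in
   m^2 (d psi) <= m^4 = 0 for all u in m^3, since u e_i is in m^2 (rows of d). *)
Lemma mxm1_of_mxm2 i (psi : 'cV[R]_(b i)) : mxm 2 (d i *m psi) -> mxm 1 psi.
Proof.
move=> mdpsi k l; rewrite ord1 ideal_exp1E // => {l}.
apply: contrapT => /(maximal_idealP maxm)[u [s [mu e1]]].
apply: m3; apply/seteqP; split=> [x mx|_ ->]; last first.
  by case: (ideal_ideal_exp 3 idealm).
have [|y my xe] := @tail_linear3 _ _ dP i (x *: delta_mx 0 k).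
  move=> j l; rewrite !mxE mulrC; case: (ideal_ideal_exp 3 idealm) => _ _ mZ.
  exact: mZ.
have /matrixP/(_ 0 0) : (x *: delta_mx 0 k : 'rV[R]_(b i)) *m psi = 0.
  rewrite xe -mulmxA; apply: (@mxm_ge4 4) => //.
  exact: (mxm_mul my mdpsi).
rewrite -scalemxAl -rowE !mxE => xpsi0.
rewrite /= -(mulr1 x) e1 mulrDr mulrCA xpsi0 mulr0 addr0.
have := @ideal_exp_mul _ m 3 1 x u idealm mx (ideal_exp1 mu).
by rewrite m4.
Qed.

(** This is the dual count, with columns in m, m^2 and m^3. Exactness in the middle comes from
    [mxm1_of_mxm2]; the last map into m^3 is not claimed to be onto, hence an inequality. *)
Lemma collen_le i :
  (b i.+2 * ell 2 + collen i <= b i.+3 * ell 3 + b i.+1 * ell 1)%N.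
Proof.
have := len_mulmx (d i.+2) (submodule_mxm 2 (b i.+2) 1).
have := len_mulmx (d i.+1) (submodule_mxm 1 (b i.+1) 1).
rewrite !len_mxm !muln1.
have -> : mxm 1 `&` [set x | d i.+1 *m x = 0] =
    [set d i *m x | x in [set: 'cV[R]_(b i)]].
  apply/seteqP; split=> [x [mx /(tail_dual_exact dP)[y ->]]|_ [y _ <-]].
    by exists y.
  split; last by apply/(tail_dual_exact dP); exists y.
  by apply: (@mxm_mul 1 0); [exact: (tail_minimal dP _)|rewrite mxm0E].
have -> : mxm 2 `&` [set x | d i.+2 *m x = 0] =
    [set d i.+1 *m x | x in @mxm 1 (b i.+1) 1].
  apply/seteqP; split=> [x [mx /(tail_dual_exact dP)[y xE]]|_ [y my <-]].
    by move: mx; rewrite xE => /mxm1_of_mxm2 my; exists y.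
  split; last by apply/(tail_dual_exact dP); exists y.
  exact: (@mxm_mul 1 1) (tail_minimal dP _) my.
have : (len [set d i.+2 *m X | X in @mxm 2 (b i.+2) 1] <=
        len (@mxm 3 (b i.+3) 1))%N.
  apply: len_sub; last exact: finite_length_mx.
  by move=> _ [x mx <-]; exact: (@mxm_mul 1 2) (tail_minimal dP _) mx.
rewrite len_mxm muln1 -/(collen i); lia.
Qed.

End OneTail.

(** * Length counts for two resolutions together *)

Section TwoTails.
Variables (b c : nat -> nat).
Variables (d : forall i, 'M[R]_(b i.+1, b i)) (e : forall i, 'M[R]_(c i.+1, c i)).
Hypotheses (dP : linear_tail d) (eP : linear_tail e).

(* The homomorphisms from a syzygy of one resolution to the dual of a syzygy of
   the other. *)
Definition hom_dual n p : set 'M[R]_(b n.+1, c p.+1) :=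
  [set X | d n.+1 *m X = 0 /\ X *m (e p.+1)^T = 0].

Arguments hom_dual n p : clear implicits.

Definition homlen n p := len (hom_dual n p).

Lemma homlen_shift n p :
  (homlen n.+1 p + c p.+1 * collen d n = homlen n p.+1 + b n.+1 * collen e p)%N.
Proof.
(* The length of J is computed twice. Left multiplication by d maps J onto [hom_dual n.+1 p], right
   multiplication by the transpose of e maps it onto [hom_dual n p.+1], and both kernels are given
   by [len_dual_kernel]. *)
pose J : set 'M[R]_(b n.+1, c p.+1) :=
  [set X | d n.+1 *m X *m (e p.+1)^T = 0].
have smJ : submodule J.
  split=> [|X Y JX JY|r X JX]; rewrite /J /=.
  - by rewrite mulmx0 mul0mx.
  - by rewrite mulmxDr mulmxDl (JX : _ = 0) (JY : _ = 0) addr0.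
  - by rewrite -scalemxAr -scalemxAl (JX : _ = 0) scaler0.
have H1 : len J = (homlen n.+1 p + c p.+1 * collen d n)%N.
  rewrite (len_mulmx (d n.+1) smJ) addnC -(len_dual_kernel dP) /homlen.
  congr addn; congr len; apply/seteqP; split.
  - move=> _ [X JX <-]; split; last exact: JX.
    by rewrite mulmxA (tail_complex dP) mul0mx.
  - move=> X [/(tail_dual_exact_mx dP)[Y ->] Ye]; exists Y => //.
  - by move=> X [].
  - by move=> X /= dX; split=> //; rewrite /J /= dX mul0mx.
rewrite -H1 (len_mulmxr (e p.+1)^T smJ) addnC -(len_dual_kernel eP) /homlen.
set K := [set X | e p.+1 *m X = 0].
have smK : submodule K by exact: (submodule_ker (mulmx (e p.+1))).
rewrite -(len_trmx smK).
congr addn; congr len; apply/seteqP; split.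
- move=> _ [X JX <-]; split; first by rewrite mulmxA.
  by rewrite -mulmxA -trmx_mul (tail_complex eP) linear0 mulmx0.
- move=> X [dX Xe].
  have /(tail_dual_exact_mx eP)[Y YE] : e p.+2 *m X^T = 0.
    by rewrite -[e _]trmxK -trmx_mul Xe linear0.
  exists Y^T; last by rewrite -trmx_mul -YE trmxK.
  by rewrite /J /= -mulmxA -trmx_mul -YE trmxK.
- move=> X [JX Xe]; exists X^T; last exact: trmxK.
  by rewrite /K /= -[e _]trmxK -trmx_mul Xe linear0.
- move=> _ [X eX <-]; have Xe : X^T *m (e p.+1)^T = 0.
    by rewrite -trmx_mul (eX : _ = 0) linear0.
  by split=> //; rewrite /J /= -mulmxA Xe mulmx0.
Qed.

(** Multiplying [homlen_shift] by [ell 0] and replacing each b [ell 0] and c [ell 0] by a sum of two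
    consecutive [collen] shows that [ell 0 * homlen n p - collen d n * collen e p] depends on n + p
    only. *)
Lemma homlen_diag n p :
  (ell 0 * homlen n p + collen d (n + p) * collen e 0 =
   ell 0 * homlen (n + p) 0 + collen d n * collen e p)%N.
Proof.
elim: p n => [|p IHp] n; first by rewrite addn0.
rewrite addnS -addSn; have := IHp n.+1; have := homlen_shift n p.
have := collen_rec dP n; have := collen_rec eP p.
nia.
Qed.

(** Matrices with entries in m^3 are killed by both differentials, because m^4 = 0. *)
Lemma homlen_ge n p : (b n.+1 * c p.+1 * ell 3 <= homlen n p)%N.
Proof.
rewrite -len_mxm; apply: len_sub; last exact: finite_length_mx.
move=> X mX; split; apply: (@mxm_ge4 4) => //.
  exact: (@mxm_mul 1 3) (tail_minimal dP _) mX.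
apply: (@mxm_mul 3 1) mX _ => i j; rewrite mxE; exact: tail_minimal.
Qed.

Lemma homlen_le n p : (homlen n p <= b n.+1 * c p.+1 * ell 0)%N.
Proof. by rewrite -len_mx; apply: len_sub => //; exact: finite_length_mx. Qed.

(** The error term involves n and p only through b at n + p + 1, so it grows with the base of b
    alone. *)
Lemma collen_mul_ge n p :
  (b n.+1 * c p.+1 * (ell 0 * ell 3) <=
   collen d n * collen e p + b (n + p).+1 * (c 1 * ell 0 ^ 2))%N.
Proof.
have := homlen_ge n p; have := homlen_le (n + p) 0; have := homlen_diag n p.
set x := homlen n p; set y := homlen (n + p) 0; rewrite -mulnn.
move=> E Hy Hx.
have Hx' := leq_mul (leqnn (ell 0)) Hx.
have Hy' := leq_mul (leqnn (ell 0)) Hy.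
lia.
Qed.

End TwoTails.

End LocalRing.

(** * Growth *)

Section Growth.
Variable K : realType.
Implicit Types (u : nat -> nat) (a l : K).

(** The limit l may be 0; then u is negligible against a^n. *)
Definition growth u a l := (fun n => (u n)%:R / a ^+ n) @ \oo --> l.

Lemma growth_shift u a l k :
  0 < a -> growth u a l -> growth (fun n => u (n + k)%N) a (l * a ^+ k).
Proof.
move=> a0 gu; rewrite /growth.
have -> : (fun n => (u (n + k)%N)%:R / a ^+ n) =
          (fun n => (u (n + k)%N)%:R / a ^+ (n + k) * a ^+ k).
  by apply/funext => n; rewrite exprD; field; rewrite !expf_eq0 !gt_eqF ?andbF.
apply: cvgM; last exact: cvg_cst.
by rewrite (cvg_shiftn k (fun n => (u n)%:R / a ^+ n)).
Qed.

Lemma growthD u v a l l' :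
  growth u a l -> growth v a l' -> growth (fun n => u n + v n)%N a (l + l').
Proof.
move=> gu gv; rewrite /growth.
under eq_fun do rewrite natrD mulrDl.
exact: cvgD.
Qed.

Lemma growthM u a l c : growth u a l -> growth (fun n => u n * c)%N a (l * c%:R).
Proof.
move=> gu; rewrite /growth.
under eq_fun do rewrite natrM mulrAC.
by apply: cvgM => //; exact: cvg_cst.
Qed.

Lemma growthB u v a l l' :
  growth (fun n => u n + v n)%N a l -> growth v a l' -> growth u a (l - l').
Proof.
move=> guv gv; rewrite /growth.
have -> : (fun n => (u n)%:R / a ^+ n) =
          (fun n => (u n + v n)%:R / a ^+ n - (v n)%:R / a ^+ n).
  by apply/funext => n; rewrite natrD -mulrBl addrK.
exact: cvgB.
Qed.

Lemma growth_unique u a l l' : growth u a l -> growth u a l' -> l = l'.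
Proof. by move=> gu gu'; exact: (cvg_unique _ gu gu'). Qed.

Lemma growth_le u v a l l' : 0 < a -> growth u a l -> growth v a l' ->
  (forall n, u n <= v n)%N -> l <= l'.
Proof.
move=> a0 gu gv uv; apply: ler_cvg_to gu gv _.
by near=> n; rewrite ler_pM2r ?ler_nat // invr_gt0 exprn_gt0.
Unshelve. all: by end_near. Qed.

Lemma cvg_div_expr0 a l : 1 < a -> (fun n => l / a ^+ n) @ \oo --> 0.
Proof.
move=> a1; have a0 := lt_trans ltr01 a1.
have -> : (fun n => l / a ^+ n) = geometric l a^-1.
  by apply/funext => n; rewrite /geometric /= exprVn.
by apply: cvg_geometric; rewrite ger0_norm ?invf_lt1 // invr_ge0 ltW.
Qed.

(** A bounded error vanishes after division by a^n. *)
Lemma growth_bounded u v a l c : 1 < a -> growth u a l ->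
  (forall n, u n <= v n + c)%N -> (forall n, v n <= u n + c)%N -> growth v a l.
Proof.
move=> a1 gu uv vu; have c0 := @cvg_div_expr0 a c%:R a1.
apply: (squeeze_cvgr (f := fun n => (u n)%:R / a ^+ n - c%:R / a ^+ n)
                     (h := fun n => (u n)%:R / a ^+ n + c%:R / a ^+ n)).
- near=> n; have an0 : 0 <= (a ^+ n)^-1.
    by rewrite invr_ge0 exprn_ge0 // ltW // (lt_trans ltr01).
  rewrite -mulrBl -mulrDl !ler_wpM2r //; first by rewrite -natrD ler_nat.
  by rewrite lerBlDr -natrD ler_nat.
- by rewrite -[l]subr0; exact: cvgB.
- by rewrite -[l]addr0; exact: cvgD.
Unshelve. all: by end_near. Qed.

Lemma growth_slower u a b l : 0 < a -> a < b -> growth u a l -> growth u b 0.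
Proof.
move=> a0 ab gu; have b0 := lt_trans a0 ab; rewrite /growth.
have -> : (fun n => (u n)%:R / b ^+ n) =
          (fun n => (u n)%:R / a ^+ n * (a / b) ^+ n).
  apply/funext => n; rewrite expr_div_n; field.
  by rewrite !expf_eq0 !gt_eqF ?andbF.
rewrite -[X in _ --> X](mulr0 l); apply: cvgM => //; apply: cvg_expr.
by rewrite ger0_norm ?divr_ge0 ?ltW // ltr_pdivrMr ?mul1r.
Qed.

Lemma exponential_growthE u a :
  exponential_growth u a -> 1 < a /\ exists2 l, 0 < l & growth u a l.
Proof.
case=> a1 [l [rho [l0 rho0 bu]]]; split=> //; exists l => //.
have a0 := lt_trans ltr01 a1.
apply: (squeeze_cvgr (f := fun n => l - rho n / a ^+ n)
                     (h := fun n => l + rho n / a ^+ n)).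
- near=> n; have an0 : 0 < a ^+ n by rewrite exprn_gt0.
  rewrite ler_pdivlMr // ler_pdivrMr // mulrBl mulrDl !divfK ?gt_eqF //.
  by near: n.
- by rewrite -[X in _ --> X]subr0; apply: cvgB => //; exact: cvg_cst.
- by rewrite -[X in _ --> X]addr0; apply: cvgD => //; exact: cvg_cst.
Unshelve. all: by end_near. Qed.

End Growth.

Arguments growth_shift {K u a l} k _ _.
Arguments growthM {K u a l} c _.

(** * The length relations in the limit *)

Section TailGrowth.
Variables (R : comNzRingType) (m : set R).
Hypotheses (maxm : maximal_ideal m) (noethR : noetherian R).
Hypotheses (m4 : ideal_exp m 4 = [set 0]) (m3 : ideal_exp m 3 <> [set 0]).
Variable K : realType.

Local Notation l0 := ((ell m 0)%:R : K).
Local Notation l1 := ((ell m 1)%:R : K).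
Local Notation l2 := ((ell m 2)%:R : K).
Local Notation l3 := ((ell m 3)%:R : K).

Section OneTail.
Variables (b : nat -> nat) (d : forall i, 'M[R]_(b i.+1, b i)).
Hypothesis dP : linear_tail m d.
Variables (a l : K).
Hypotheses (a1 : 1 < a) (lgt0 : 0 < l) (gb : growth b a l).

Let a0 : 0 < a. Proof. exact: lt_trans a1. Qed.

Lemma growth_rowlen :
  growth (fun n => rowlen d (n + 2)) a (l * (l3 + l1 * a ^+ 2 - l2 * a)).
Proof.
have -> : l * (l3 + l1 * a ^+ 2 - l2 * a) =
    (l * l3 + l * a ^+ 2 * l1) - l * a ^+ 1 * l2 by ring.
apply: (growthB (v := fun n => b (n + 1) * ell m 2)%N).
  have -> : (fun n => rowlen d (n + 2) + b (n + 1) * ell m 2)%N =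
            (fun n => b n * ell m 3 + b (n + 2) * ell m 1)%N.
    apply/funext => n; rewrite !addn1 !addn2.
    exact: (rowlen_linear maxm noethR m4 dP).
  by apply: growthD; apply: growthM => //; exact: growth_shift.
by apply: growthM => //; exact: growth_shift.
Qed.

(** Limit of [rowlen_rec]. Since [ell 0] = [ell 1] + 1, it says p(a) = 0 for p(x) = x^3 - e x^2 +
    h_2 x - h_3. *)
Lemma growth_characteristic :
  (l3 + l1 * a ^+ 2 - l2 * a) * (1 + a) = l0 * a ^+ 3.
Proof.
have g2 := growth_rowlen; have g3 := growth_shift 1 a0 g2.
have gD := growthD g2 g3.
have gB := growthM (ell m 0) (growth_shift 3 a0 gb).
have E : (fun n => rowlen d (n + 2) + rowlen d (n + 1 + 2))%N =
         (fun n => b (n + 3) * ell m 0)%N.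
  apply/funext => n; rewrite addn1 !addn2 addn3.
  exact: (rowlen_rec maxm noethR m4 dP).
rewrite E in gD; have {E gD gB} := growth_unique gD gB => E.
by apply: (mulfI (lt0r_neq0 lgt0)); lra.
Qed.

(** [rowlen] and [collen] satisfy the same recursion x_n + x_(n+1) = b_(n+1) l_0, so their
    difference only alternates in sign. It stays bounded, and the two limits agree. *)
Lemma growth_collen :
  growth (fun n => collen d (n + 2)) a (l * l0 * a ^+ 3 / (1 + a)).
Proof.
have a10 : 1 + a != 0 by rewrite gt_eqF // addr_gt0.
have -> : l * l0 * a ^+ 3 / (1 + a) = l * (l3 + l1 * a ^+ 2 - l2 * a).
  by rewrite -[l * l0 * _]mulrA -growth_characteristic; field.
have alt n :
    (rowlen d n + collen d 0 = collen d n + rowlen d 0 \/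
     rowlen d n + rowlen d 0 = collen d n + collen d 0)%N.
  elim: n => [|n IHn]; first by left; rewrite addnC.
  have := rowlen_rec maxm noethR m4 dP n.
  have := collen_rec maxm noethR m4 dP n.
  by case: IHn; [right|left]; lia.
apply: (growth_bounded (c := collen d 0 + rowlen d 0) a1 growth_rowlen) => n.
  by have := alt (n + 2)%N; lia.
by have := alt (n + 2)%N; lia.
Qed.

(** Limit of [collen_le]; multiplied by 1 + a, it says a^3 p(1/a) <= 0. *)
Lemma growth_dual_le : l2 * a + l0 / (1 + a) <= l3 * a ^+ 2 + l1.
Proof.
have gl := growthD (growthM (ell m 2) (growth_shift 4 a0 gb)) growth_collen.
have gr := growthD (growthM (ell m 3) (growth_shift 5 a0 gb))
                   (growthM (ell m 1) (growth_shift 3 a0 gb)).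
have := growth_le a0 gl gr.
have -> : l * a ^+ 4 * l2 + l * l0 * a ^+ 3 / (1 + a) =
          l * a ^+ 3 * (l2 * a + l0 / (1 + a)) by ring.
have -> : l * a ^+ 5 * l3 + l * a ^+ 3 * l1 =
          l * a ^+ 3 * (l3 * a ^+ 2 + l1) by ring.
rewrite ler_pM2l ?mulr_gt0 ?exprn_gt0 //; apply => n.
rewrite addn2 addn3 !addnS addn0.
exact: (collen_le maxm noethR m4 m3 dP).
Qed.

End OneTail.

(** Two successive limits in [collen_mul_ge]: first in p with n fixed, then in n. *)
Lemma growth_hom_le (b c : nat -> nat) (d : forall i, 'M[R]_(b i.+1, b i))
    (e : forall i, 'M[R]_(c i.+1, c i)) (a a' l l' : K) :
  linear_tail m d -> linear_tail m e -> 1 < a -> a < a' -> 0 < l -> 0 < l' ->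
  growth b a l -> growth c a' l' -> l3 * (1 + a) * (1 + a') <= l0.
Proof.
move=> dP eP a1 aa' lgt0 lgt0' gb gc.
have a0 := lt_trans ltr01 a1; have a0' := lt_trans a0 aa'.
have a1' := lt_trans a1 aa'.
have l0_gt0 : 0 < l0 by rewrite ltr0n (ell0 maxm noethR m4).
(* For fixed n, the error term is of order a^p and disappears after division by a'^p, as a < a'. *)
have le_n n : (b (n + 3))%:R * (l3 * (1 + a')) <= (collen d (n + 2))%:R :> K.
  have gl := growthM (b (n + 3) * (ell m 0 * ell m 3))%N
    (growth_shift 3 a0' gc).
  have gr := growthD
    (growthM (collen d (n + 2)) (growth_collen eP a1' lgt0' gc))
    (growthM (c 1 * ell m 0 ^ 2)%N
      (growth_slower a0 aa' (growth_shift (n + 5) a0 gb))).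
  have := growth_le a0' gl gr; rewrite mul0r addr0 !natrM.
  have -> : l' * a' ^+ 3 * ((b (n + 3))%:R * (l0 * l3)) =
    (l' * a' ^+ 3 * l0 / (1 + a')) * ((b (n + 3))%:R * (l3 * (1 + a'))).
    by field; rewrite gt_eqF // addr_gt0.
  have -> : l' * l0 * a' ^+ 3 / (1 + a') = l' * a' ^+ 3 * l0 / (1 + a').
    by ring.
  rewrite ler_pM2l ?mulr_gt0 ?exprn_gt0 ?invr_gt0 ?addr_gt0 //; apply => p.
  have := collen_mul_ge maxm noethR m4 dP eP (n + 2) (p + 2).
  by rewrite !(addn2, addn3, addnS, addn0, addSn) [(p + n)%N]addnC; lia.
have := growth_collen dP a1 lgt0 gb.
have gl : (fun n => (b (n + 3)%N)%:R / a ^+ n * (l3 * (1 + a'))) @ \oo -->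
    l * a ^+ 3 * (l3 * (1 + a')).
  by apply: cvgM; [exact: growth_shift|exact: cvg_cst].
move=> /(ler_cvg_to gl) => H.
have : l * a ^+ 3 * (l3 * (1 + a')) <= l * l0 * a ^+ 3 / (1 + a).
  apply: H; near=> n => /=.
  by rewrite mulrAC ler_pM2r ?invr_gt0 ?exprn_gt0.
have -> : l * l0 * a ^+ 3 / (1 + a) = l * a ^+ 3 * (l0 / (1 + a)) by ring.
rewrite ler_pM2l ?mulr_gt0 ?exprn_gt0 // ler_pdivlMr ?addr_gt0 //.
by rewrite mulrAC.
Unshelve. all: by end_near. Qed.

End TailGrowth.

(** * Arithmetic of the roots of the characteristic polynomial *)

Lemma intr_ge0_lt1 (K : realType) (z : int) :
  0 <= z%:~R :> K -> z%:~R < 1 :> K -> z%:~R = 0 :> K.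
Proof. by rewrite ler0z -[1]/(1%:~R) ltr_int => ? ?; have -> : z = 0 by lia. Qed.

Lemma no_two_bases (K : realType) (L0 L1 L2 L3 : nat) (a b : K) :
  L0 = L1.+1 -> (0 < L3)%N -> 1 < a -> a < b ->
  (L3%:R + L1%:R * a ^+ 2 - L2%:R * a) * (1 + a) = L0%:R * a ^+ 3 ->
  (L3%:R + L1%:R * b ^+ 2 - L2%:R * b) * (1 + b) = L0%:R * b ^+ 3 ->
  L2%:R * a + L0%:R / (1 + a) <= L3%:R * a ^+ 2 + L1%:R ->
  L3%:R * (1 + a) * (1 + b) <= L0%:R -> False.
Proof.
move=> ->; rewrite -natr1; set l1 := L1%:R; set l2 := L2%:R; set l3 := L3%:R.
move=> L3_gt0 a1 ab pa pb dual hom.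
have l3_gt0 : 0 < l3 by rewrite ltr0n.
(* The third root of p, defined by the sum of the roots being e. The other two Vieta relations
   follow from (p(a) - p(b)) / (a - b) = 0 and from p(a) = 0. *)
pose c := l1 - l2 - a - b.
have h2E : l2 - l3 = a * b + c * (a + b).
  by apply: (mulfI (x := a - b)); [by rewrite subr_eq0 lt_eqF|rewrite /c; lra].
have h3E : l3 = a * b * c.
  by have : a * (l2 - l3) = a * (a * b + c * (a + b)); [rewrite h2E|rewrite /c; lra].
have eE : l1 - l2 = a + b + c by rewrite /c; ring.
clearbody c.
have ab_gt0 : 0 < (a - 1) * (b - 1) by apply: mulr_gt0; lra.
have ab1 : 1 < a * b by lra.
have c_gt0 : 0 < c by move: l3_gt0; rewrite h3E pmulr_rgt0 //; lra.
(* Since l_0 = 1 + e + h_2 + h_3 = (1 + a)(1 + b)(1 + c), the factor (1 + a)(1 + b) cancels in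
   [hom]. *)
have c1l : a * b * c <= 1 + c.
  rewrite -h3E -(ler_pM2l (x := (1 + a) * (1 + b))); last by apply: mulr_gt0; lra.
  lra.
(* The product below is - a^3 p(1/a), and its first two factors are positive. *)
have ac1 : 1 <= a * c.
  have : 0 <= (a * b - 1) * (a ^+ 2 - 1) * (a * c - 1).
    have -> : (a * b - 1) * (a ^+ 2 - 1) * (a * c - 1) =
      l3 * a ^+ 3 - (l2 - l3) * a ^+ 2 + (l1 - l2) * a - 1.
      by rewrite h2E eE h3E; ring.
    move: dual; rewrite -(ler_pM2r (x := 1 + a)); last by lra.
    by rewrite mulrDl divfK; [lra|rewrite gt_eqF //; lra].
  by rewrite pmulr_rge0 ?subr_ge0 // mulr_gt0 ?subr_gt0 // exprn_egt1.
(* Here h_3 = b (a c) >= b > 1, and h_3 is an integer. *)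
have L3_ge2 : (2 <= L3)%N.
  have : 0 <= b * (a * c - 1) by apply: mulr_ge0; lra.
  by rewrite -(ltr_nat K) -/l3 h3E; lra.
have l3_ge2 : 2 <= l3 by rewrite ler_nat.
have c_ge1 : 1 <= c by lra.
have c1 : c = 1.
  (* Both sides are - p(1), an integer. *)
  have zE : ((L1%:Z - 2 * L2%:Z + 2 * L3%:Z - 1)%:~R : K) =
            (a - 1) * (b - 1) * (c - 1).
    rewrite !(rmorphB, rmorphD, rmorphM) /= -!pmulrn -/l1 -/l2 -/l3.
    lra.
  have z0 := @intr_ge0_lt1 K (L1%:Z - 2 * L2%:Z + 2 * L3%:Z - 1).
  rewrite zE in z0.
  (* Expanding and using a b c <= 1 + c bounds (a - 1)(b - 1)(c - 1) by 1 - (a - 1)(b - 1) - (a + b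
     - 2) c, which is less than 1. *)
  have abc_gt0 : 0 < (a + b - 2) * c by apply: mulr_gt0; lra.
  have /eqP : (a - 1) * (b - 1) * (c - 1) = 0.
    apply: z0; first by apply: mulr_ge0; [exact: ltW|lra].
    by lra.
  by rewrite mulf_eq0 (gt_eqF ab_gt0) /= subr_eq0 => /eqP.
have ab2 : a * b = 2 by rewrite c1 in h3E c1l; lra.
(* This integer e - 3 is positive as a, b > 1, and less than 1 because (a - 1)(b - 1) > 0 and a b =
   2. *)
have abz : ((L1%:Z - L2%:Z - 3)%:~R : K) = a + b - 2.
  rewrite !rmorphB /= -!pmulrn -/l1 -/l2; lra.
have := @intr_ge0_lt1 K (L1%:Z - L2%:Z - 3); rewrite abz => ab0.
have : a + b - 2 = 0 by apply: ab0; lra.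
lra.
Qed.

(** * Uniqueness of the base, and linear tails of minimal resolutions *)

Section Tails.
Variables (R : comNzRingType) (m : set R).
Hypotheses (maxm : maximal_ideal m) (noethR : noetherian R).
Hypotheses (m4 : ideal_exp m 4 = [set 0]) (m3 : ideal_exp m 3 <> [set 0]).

Lemma growth_base_unique (K : realType) (b c : nat -> nat)
    (d : forall i, 'M[R]_(b i.+1, b i)) (e : forall i, 'M[R]_(c i.+1, c i))
    (a a' l l' : K) :
  linear_tail m d -> linear_tail m e -> 1 < a -> 1 < a' -> 0 < l -> 0 < l' ->
  growth b a l -> growth c a' l' -> a = a'.
Proof.
wlog aa' : a a' b c d e l l' / a < a'.
  move=> W dP eP a1 a1' lgt0 lgt0' gb gc; have [aa'|aa'|//] := ltgtP a a'.
    exact: (W a a' _ _ d e l l').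
  by apply/esym/(W a' a _ _ e d l' l).
move=> dP eP a1 a1' lgt0 lgt0' gb gc; exfalso.
apply: (@no_two_bases K (ell m 0) (ell m 1) (ell m 2) (ell m 3) a a') => //.
- exact: (ell0 maxm noethR m4).
- exact: (ell3_gt0 maxm noethR m4 m3).
- exact: (growth_characteristic maxm noethR m4 dP a1 lgt0 gb).
- exact: (growth_characteristic maxm noethR m4 eP a1' lgt0' gc).
- exact: (growth_dual_le maxm noethR m4 m3 dP a1 lgt0 gb).
- exact: (growth_hom_le maxm noethR m4 dP eP a1 aa' lgt0 lgt0' gb gc).
Qed.

Lemma smul_setTP (I : set R) n (v : 'rV[R]_n) :
  ideal I -> (I *s setT) v <-> entries_in I 1 n v.
Proof.
move=> iI; split=> [[s [sP ->]]|Iv].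
  apply: submodule_sum; first exact: submodule_entries_in.
  move=> p /sP[Ip _] i j; rewrite mxE mulrC.
  by case: iI => _ _; apply.
exists [seq (v 0 j, delta_mx 0 j) | j <- enum 'I_n]; split.
  by move=> _ /mapP[j _ ->]; split=> //; exact: Iv.
by rewrite big_map big_enum {1}(row_sum_delta v).
Qed.

Variables (M : lmodType R) (F : free_resolution M).
Hypothesis minF : minimal m F.

Let idealm : ideal m. Proof. by case: maxm. Qed.

Lemma filtP q n (v : 'rV[R]_n) : filt m q%:Z v <-> mxm m q v.
Proof. exact/smul_setTP/ideal_ideal_exp. Qed.

Lemma minimal_dif i : mxm m 1 (dif F i).
Proof.
move=> k j; have := minF (delta_mx 0 k).
move=> /(smul_setTP _ idealm)/(_ 0 j); rewrite -rowE mxE.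
by rewrite ideal_exp1E.
Qed.

(** Minimality makes every differential of F (x) k zero. *)
Lemma betti_rk (hm : maximal_ideal m) i : betti F hm i = rk F i.
Proof.
have T0 j : Tor_dif F hm j = 0.
  apply/matrixP => k l; rewrite !mxE; apply/eqP; rewrite residue_eq0.
  by apply/mem_set; have := minimal_dif k l; rewrite ideal_exp1E.
by rewrite /betti !T0 mxrank_ker !mxrank0 !subn0.
Qed.

Lemma gr_homology_step k q (u : 'rV[R]_(rk F k)) : gr_homology_eq0 m F k ->
  mxm m q.+1 u -> mxm m q.+3 (u *m dif F k) ->
  exists y z, [/\ mxm m q y, mxm m q.+2 z & u = y *m dif F k.+1 + z].
Proof.
(* Internal degree j = k + q + 1 gives the exponents q + 1 for u, q + 3 for its image, q for y and q
   + 2 for z. *)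
move=> H mu mud; have [] := H (k + q.+1)%N%:Z u.
  have e : ((k + q.+1)%N%:Z - k%:Z = q.+1%:Z) by lia.
  split; first by rewrite e; exact/filtP.
  have -> : ((k + q.+1)%N%:Z - k%:Z + 2 = q.+3%:Z) by lia.
  exact/filtP.
move=> y [z [fy fz uE]]; exists y, z; split=> //; apply/filtP.
  by have <- : ((k + q.+1)%N%:Z - k.+1%:Z = q%:Z) by lia.
by have <- : ((k + q.+1)%N%:Z - k%:Z + 1 = q.+2%:Z) by lia.
Qed.

Lemma dif_complex i : dif F i.+1 *m dif F i = 0.
Proof.
case: i => [|i]; first exact: thinmx0.
apply/row_matrixP => k; rewrite row0 row_mul; apply/dif_exact.
by exists (delta_mx 0 k); rewrite -rowE.
Qed.

(** A column f is the functional x |-> x f, and g collects the values of the extending functional on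
    the standard basis. *)
Lemma Ext_eq0_col i (f : 'cV[R]_(rk F i.+1)) : Ext_eq0 F R^o i.+1 ->
  dif F i.+2 *m f = 0 -> exists g, f = dif F i.+1 *m g.
Proof.
move=> ext df.
pose phi (x : 'rV[R]_(rk F i.+1)) : R^o := (x *m f) 0 0.
have lphi : linear phi.
  by move=> r x y; rewrite /phi mulmxDl -scalemxAl !mxE.
pose Phi : {linear 'rV[R]_(rk F i.+1) -> R^o} :=
  HB.pack phi (GRing.isLinear.Build _ _ _ _ phi lphi).
have [|psi psiE] := ext Phi.
  by move=> x; rewrite /= /phi -mulmxA df mulmx0 mxE.
exists (\col_j psi (delta_mx 0 j)); apply/matrixP => k j; rewrite ord1.
have -> : f k 0 = Phi (delta_mx 0 k) by rewrite /= /phi -rowE mxE.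
rewrite psiE -rowE {1}(row_sum_delta (row k (dif F i.+1))) linear_sum mxE.
by apply: eq_bigr => l _; rewrite linearZ !mxE.
Qed.

(** The resolution is cut beyond both the linearity defect n and the bound N for the vanishing of
    Ext. *)
Lemma linear_tail_resolution :
  eventually_linear m F -> (\forall i \near \oo, Ext_eq0 F R^o i) ->
  exists n, @linear_tail R m (fun i => rk F (i + n))
              (fun i => dif F (i + n).+1).
Proof.
move=> [n [_ [lin _]]] [N _ ext]; exists (n + N)%N.
have lin' i : gr_homology_eq0 m F (i + (n + N)) by apply: lin; lia.
split=> /= [i|i x|i f|i x mx|i x mx].
- exact: minimal_dif.
- exact: dif_exact.
- split=> [|[g ->]]; last by rewrite mulmxA dif_complex mul0mx.
  have Ni : (N <= (i + (n + N)).+1)%N by lia.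
  exact: Ext_eq0_col (ext _ Ni).
- set k := (i + (n + N))%N in x mx *.
  have mx0 p q r : mxm m p (0 : 'M[R]_(q, r)).
    by case: (submodule_mxm maxm p q r).
  (* First approximation: the boundary is y d + z with y in m and z in m^3. As z is again a cycle, a
     second application of linearity gives z = y' d + z' with y' in m^2 and z' in m^4 = 0. *)
  have [||y [z [my mz E]]] := @gr_homology_step k 1 (x *m dif F k.+1) (lin' i).
  + exact: mx.
  + by rewrite -mulmxA dif_complex mulmx0.
  have zd : z *m dif F k = 0.
    have -> : z = (x - y) *m dif F k.+1 by rewrite mulmxBl E addrAC subrr add0r.
    by rewrite -mulmxA dif_complex mulmx0.
  have [|y' [z' [my' mz' E']]] := @gr_homology_step k 2 z (lin' i) mz.
    by rewrite zd.
  have z'0 := mxm_ge4 maxm m4 (leqnn 4) mz'.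
  exists (y + y'); last by rewrite mulmxDl E E' z'0 addr0.
  have [_ mD _] := submodule_mxm maxm 1 1 (rk F k.+1).
  by apply: mD => //; apply: (mxm_le maxm (leqnSn 1)).
- set k := (i + (n + N))%N in x mx *.
  (* Since m^4 = 0, every x in m^3 F is a cycle, and one application of linearity suffices. *)
  have xd : x *m dif F k = 0.
    apply: (mxm_ge4 maxm m4 (leqnn 4)).
    exact: (mxm_mul maxm mx (@minimal_dif k)).
  have [|y [z [my mz ->]]] := @gr_homology_step k 2 x (lin' i) mx.
    by rewrite xd; case: (submodule_mxm maxm 5 1 (lower (rk F) k)).
  by exists y => //; rewrite (mxm_ge4 maxm m4 (leqnn 4) mz) addr0.
Qed.

End Tails.

Theorem theorem4p3p2 (R : comNzRingType) (m : set R)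
    (noethR : noetherian R) (localR : local_ring m)
    (m4 : ideal_exp m 4 = [set 0]) (m3 : ideal_exp m 3 <> [set 0])
    (M N : lmodType R)
    (fgM : finitely_generated M) (fgN : finitely_generated N)
    (F : free_resolution M) (G : free_resolution N)
    (minF : minimal m F) (minG : minimal m G)
    (linF : eventually_linear m F) (linG : eventually_linear m G)
    (extM : \forall i \near \oo, Ext_eq0 F R^o i)
    (extN : \forall i \near \oo, Ext_eq0 G R^o i)
    (K : realType) (a b : K)
    (growM : exponential_growth (betti F (local_maximal localR)) a)
    (growN : exponential_growth (betti G (local_maximal localR)) b) :
  a = b.
Proof.
have maxm := local_maximal localR.
have [p tF] := linear_tail_resolution maxm m4 minF linF extM.
have [q tG] := linear_tail_resolution maxm m4 minG linG extN.
have [a1 [l lgt0 gF]] := exponential_growthE growM.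
have [b1 [l' lgt0' gG]] := exponential_growthE growN.
have a0 := lt_trans ltr01 a1; have b0 := lt_trans ltr01 b1.
have bE (L : lmodType R) (H : free_resolution L) : minimal m H ->
    betti H (local_maximal localR) = rk H.
  by move=> minH; apply/funext => i; exact: betti_rk.
rewrite bE // in gF; rewrite bE // in gG.
(* Dropping the first p terms keeps the base and multiplies the limit l by a^p; likewise for q. *)
apply: (growth_base_unique maxm noethR m4 m3 tF tG a1 b1 _ _
         (growth_shift p a0 gF) (growth_shift q b0 gG)).
  by rewrite mulr_gt0 ?exprn_gt0.
by rewrite mulr_gt0 ?exprn_gt0.
Qed.
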